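(* Let $r\in\mathbb{Z}/(q-1)\mathbb{Z}$, and let $(I,\gamma)$ and $(I',\gamma')$ be two types. Then $(I',\gamma')\le_r(I,\gamma)$ if and only if the following two conditions are satisfied: (i) $\gamma'\preceq\gamma$; (ii) $I'\subseteq I\cup I(r-2\gamma,\,2(\gamma\ominus\gamma'))\cup I(\gamma\ominus\gamma',\,\gamma\ominus\gamma')$.
   Context: Let $p$ be an odd prime, $f\ge1$, $q=p^f$. Monoid. $\widetilde{\mathbb{N}}$ is the quotient monoid of $(\mathbb{N}\cup\{0\},+)$ by: $a\sim b$ iff $a=b=0$, or $a,b>0$ and $a\equiv b\bmod q-1$. Each $\alpha\in\widetilde{\mathbb{N}}$ contains a unique integer $\sum_{i=0}^{f-1}\alpha_ip^i$ with digits $0\le\alpha_i\le p-1$; indices are in $\mathbb{Z}/f\mathbb{Z}$. $\widetilde{\mathbb{N}}\setminus\{0\}$ is identified with $\mathbb{Z}/(q-1)\mathbb{Z}$, so $r\in\widetilde{\mathbb{N}}\setminus\{0\}$. Write $\alpha\preceq\beta$ iff $\alpha_i\le\beta_i$ for all $i$; then $\beta\ominus\alpha$ is the element with digits $\beta_i-\alpha_i$. For $a\ne0$, $a-b$ is the unique $c\in\widetilde{\mathbb{N}}\setminus\{0\}$ with $b+c=a$. Carry sets. For $\alpha,\beta\in\widetilde{\mathbb{N}}$, $I(\alpha,\beta)\subseteq\mathbb{Z}/f\mathbb{Z}$ is the unique subset such that for all $i$: $\alpha_i+\beta_i\le p-1$ if $i-1,i\notin I(\alpha,\beta)$; $\alpha_i+\beta_i\le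 p-2$ if $i-1\in I(\alpha,\beta)$, $i\notin I(\alpha,\beta)$; $\alpha_i+\beta_i\ge p$ if $i-1\notin I(\alpha,\beta)$, $i\in I(\alpha,\beta)$; $\alpha_i+\beta_i\ge p-1$ if $i-1,i\in I(\alpha,\beta)$; and $I(\alpha,\beta)=\varnothing$ if $\alpha_i+\beta_i=p-1$ for all $i$. Types. Put $\Theta=(\widetilde{\mathbb{N}}\cup\{\infty\})\times\widetilde{\mathbb{N}}$. Let $\le_r$ be the smallest preorder on $\Theta$ such that, for $m\in\{0,\dots,f-1\}$ and $j_1\in\widetilde{\mathbb{N}}$: (1) $(j_0\ominus p^m,j_1)\le_r(j_0,j_1)$ if $j_0\in\widetilde{\mathbb{N}}$, $p^m\preceq j_0$; (2) $(j_0,j_1\ominus p^m)\le_r(j_0,j_1)$ if $j_0\in\widetilde{\mathbb{N}}$, $p^m\preceq j_1$; (3) $(j_0+p^m,j_1\ominus p^m)\le_r(j_0,j_1)$ if $j_0\in\widetilde{\mathbb{N}}$, $p^m\preceq j_1$; (4) $(r-2j_1-j_0,j_1)\le_r(j_0,j_1)$ if $j_0\notin\{0,\infty\}$; (5) $(r-2j_1,j_1\ominus p^m)\le_r(\infty,j_1)$ if $p^m\preceq j_1$; (6) $((r-2j_1)\ominus p^m,j_1)\le_r(\infty,j_1)$ if $p^m\preceq r-2j_1$; (7) $(0,j_1)\le_r(\infty,j_1)$ and $(\infty,j_1)\le_r(0,j_1)$. Two elements are equivalent if each is $\le_r$ the other. A type is an equivalence class, and $\le_r$ induces a partial order, also denoted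 $\le_r$, on types. The class of $(j_0,j_1)$ is encoded by the pair $(I(j_0',r-2j_1-j_0'),j_1)\in\mathcal{P}(\mathbb{Z}/f\mathbb{Z})\times\widetilde{\mathbb{N}}$ for any representative $(j_0',j_1)$ with $j_0'\in\widetilde{\mathbb{N}}$; this encoding is well defined and injective, and types are written as such pairs $(I,\gamma)$. *)

(* Defs.v *)
From HB Require Import structures.
From mathcomp Require Import all_boot all_order all_algebra.
From mathcomp Require Import zify.
From mathcomp Require Import boolp.

Set Implicit Arguments.
Unset Strict Implicit.
Unset Printing Implicit Defensive.

Import Order.TTheory GRing.Theory.

Lemma sum_digits p n k : 0 < p ->
  (\sum_(i < k) (n %/ p ^ i) %% p * p ^ i = n %% p ^ k)%N.
Proof.
move=> p_gt0; elim: k => [|k IHk]; first by rewrite big_ord0 modn1.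
rewrite big_ord_recr /= IHk.
have pk_gt0 : 0 < p ^ k by rewrite expn_gt0 p_gt0.
rewrite [in RHS](divn_eq n (p ^ k)) [in RHS](divn_eq (n %/ p ^ k) p).
rewrite mulnDl -addnA -mulnA -expnS modnMDl [RHS]modn_small; first by rewrite addnC.
have := ltn_pmod n pk_gt0; have := ltn_pmod (n %/ p ^ k) p_gt0.
rewrite expnS; move: (_ %% _) (_ %% _) => x y; nia.
Qed.

Lemma sum_digits_lt p (d : nat -> nat) k : (forall i, d i < p) ->
  \sum_(i < k) d i * p ^ i < p ^ k.
Proof.
move=> d_lt; elim: k => [|k IHk]; first by rewrite big_ord0.
rewrite big_ord_recr /= expnS.
have : (d k).+1 * p ^ k <= p * p ^ k by rewrite leq_mul2r d_lt orbT.
by rewrite mulSn; apply: leq_trans; rewrite ltn_add2r.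
Qed.

Lemma digit_sum p (d : nat -> nat) k j : (forall i, d i < p) -> j < k ->
  (\sum_(i < k) d i * p ^ i) %/ p ^ j %% p = d j.
Proof.
move=> d_lt; elim: k => // k IHk; rewrite ltnS leq_eqVlt big_ord_recr /=.
have pj_gt0 : 0 < p ^ j by rewrite expn_gt0; have := d_lt 0; lia.
case/orP=> [/eqP jk|jk].
  rewrite -jk in IHk *.
  by rewrite addnC divnMDl // divn_small ?addn0 ?modn_small // sum_digits_lt.
have -> : d k * p ^ k = (d k * p ^ (k - j.+1) * p) * p ^ j.
  by rewrite -!mulnA -expnS -expnD subnK.
by rewrite addnC divnMDl // modnMDl IHk.
Qed.

(* In this file q stands for p ^ f.  Only the lemmas assume p, f to be
   such that q is at least 2. *)

(* The congruence a ~ b on (nat, +). *)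
Definition nsim (p f : nat) : rel nat := fun a b =>
  (a == 0) && (b == 0) ||
  [&& 0 < a, 0 < b & a == b %[mod (p ^ f).-1]].

Lemma nsim_refl p f : reflexive (nsim p f).
Proof. by case=> [|a]; rewrite /nsim //= eqxx. Qed.

Lemma nsim_sym p f : symmetric (nsim p f).
Proof.
by move=> [|a] [|b]; rewrite /nsim //= eq_sym.
Qed.

Lemma nsim_trans p f : transitive (nsim p f).
Proof.
move=> b a c; rewrite /nsim.
case: a b c => [|a] [|b] [|c] //= /eqP-> /eqP->; exact: eqxx.
Qed.

Canonical nsim_equiv p f :=
  EquivRel (nsim p f) (@nsim_refl p f) (@nsim_sym p f) (@nsim_trans p f).

Local Open Scope quotient_scope.

Definition Ntilde (p f : nat) : Type := {eq_quot nsim_equiv p f}.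

HB.instance Definition _ p f := Choice.on (Ntilde p f).
HB.instance Definition _ p f := EqQuotient.on (Ntilde p f).

Lemma Ntilde_eq p f a b :
  (\pi_(Ntilde p f) a == \pi_(Ntilde p f) b) = nsim p f a b.
Proof. by rewrite piE. Qed.

Definition Nadd p f (a b : Ntilde p f) : Ntilde p f :=
  \pi_(Ntilde p f) (repr a + repr b).

Lemma nsim_add p f a a' b b' :
  nsim p f a a' -> nsim p f b b' -> nsim p f (a + b) (a' + b').
Proof.
rewrite /nsim; case: a a' => [|a] [|a'] //=; case: b b' => [|b] [|b'] //=.
  by rewrite !addn0.
move=> /eqP Ha /eqP Hb; apply/eqP.
by rewrite -[LHS]modnDm Ha Hb modnDm.
Qed.

Lemma Nadd_pi p f a b :
  Nadd (\pi_(Ntilde p f) a) (\pi_(Ntilde p f) b) = \pi_(Ntilde p f) (a + b).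
Proof.
by apply/eqP; rewrite Ntilde_eq; apply: nsim_add; rewrite -Ntilde_eq reprK.
Qed.

Lemma NaddA p f : associative (@Nadd p f).
Proof.
elim/quotW=> a; elim/quotW=> b; elim/quotW=> c.
by rewrite (Nadd_pi _ _ b c) (Nadd_pi _ _ a b) !Nadd_pi addnA.
Qed.

Lemma NaddC p f : commutative (@Nadd p f).
Proof. by move=> a b; rewrite /Nadd addnC. Qed.

Lemma Nadd0 p f : left_id (\pi_(Ntilde p f) 0) (@Nadd p f).
Proof. by elim/quotW=> a; rewrite Nadd_pi. Qed.

HB.instance Definition _ p f := GRing.isNmodule.Build (Ntilde p f)
  (@NaddA p f) (@NaddC p f) (@Nadd0 p f).

Local Open Scope ring_scope.

Lemma pi_Ntilde0 p f : \pi_(Ntilde p f) 0%N = 0.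
Proof. by []. Qed.

Lemma pi_NtildeD p f a b :
  \pi_(Ntilde p f) (a + b)%N = \pi_(Ntilde p f) a + \pi_(Ntilde p f) b.
Proof. by rewrite -Nadd_pi. Qed.

Lemma pi_Ntilde_eq0 p f a : (\pi_(Ntilde p f) a == 0) = (a == 0%N).
Proof. by rewrite -pi_Ntilde0 Ntilde_eq /nsim andbT andbF orbF. Qed.

(* The representative lying between 0 and q - 1. *)
Definition canon p f (a : Ntilde p f) : nat :=
  if repr a == 0%N then 0%N else ((repr a).-1 %% (p ^ f).-1).+1.

Lemma canonK p f : cancel (@canon p f) (\pi_(Ntilde p f)).
Proof.
move=> a; rewrite -[RHS]reprK; apply/eqP; rewrite Ntilde_eq /nsim /canon.
case: (repr a) => //= n; apply/eqP.
by rewrite -addn1 modnDml addn1.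
Qed.

Lemma canon_lt p f (a : Ntilde p f) : (1 < p ^ f)%N -> (canon a < p ^ f)%N.
Proof.
rewrite /canon => q_gt1; case: ifP => _; first by lia.
have : ((repr a).-1 %% (p ^ f).-1 < (p ^ f).-1)%N by rewrite ltn_mod; lia.
lia.
Qed.

Lemma canon_uniq p f (a : Ntilde p f) n :
  (1 < p ^ f)%N -> (n < p ^ f)%N -> \pi_(Ntilde p f) n = a -> canon a = n.
Proof.
move=> q_gt1 n_lt /eqP; rewrite -{1}[a]canonK Ntilde_eq /nsim.
have := canon_lt a q_gt1; move: (canon a) => m m_lt.
case/orP => [/andP[/eqP-> /eqP->]//|/and3P[n_gt0 m_gt0]].
case: n m n_gt0 m_gt0 n_lt m_lt => [|n] [|m] // _ _ n_lt m_lt.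
rewrite -addn1 -[m.+1]addn1 eqn_modDr => /eqP.
by rewrite !modn_small => [->||]; lia.
Qed.

Definition digit p f (a : Ntilde p f) (i : 'I_f) : nat :=
  ((canon a %/ p ^ i) %% p)%N.

Lemma canon_sum p f (a : Ntilde p f) : (1 < p ^ f)%N ->
  canon a = (\sum_(i < f) digit a i * p ^ i)%N.
Proof.
move=> q_gt1; rewrite sum_digits ?modn_small ?canon_lt //.
case: posnP => // p0; move: q_gt1.
by rewrite p0; case: (f) => [|n]; rewrite ?expn0 ?exp0n.
Qed.

Definition Npow p f (m : 'I_f) : Ntilde p f := \pi_(Ntilde p f) (p ^ m)%N.
Arguments Npow p {f} m.

Definition prece p f (a b : Ntilde p f) : bool :=
  [forall i : 'I_f, (digit a i <= digit b i)%N].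

(* [ominus b a] is only meaningful when [prece a b]. *)
Definition ominus p f (b a : Ntilde p f) : Ntilde p f :=
  \pi_(Ntilde p f) (\sum_(i < f) (digit b i - digit a i) * p ^ i)%N.

Lemma digit_ominus p f (a b : Ntilde p f) i : (1 < p)%N ->
  digit (ominus b a) i = (digit b i - digit a i)%N.
Proof.
move=> p_gt1; have q_gt1 : (1 < p ^ f)%N.
  by case: f a b i => [|n] a b i; [case: i | rewrite -(exp1n n.+1) ltn_exp2r].
pose d (j : nat) := (canon b %/ p ^ j %% p - canon a %/ p ^ j %% p)%N.
have d_lt j : (d j < p)%N.
  by rewrite /d; have := @ltn_pmod (canon b %/ p ^ j) p; lia.
rewrite /digit (@canon_uniq p f _ (\sum_(j < f) d j * p ^ j)%N) //.
  by rewrite digit_sum.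
exact: sum_digits_lt.
Qed.

(* [nsub a b] is only meaningful for a != 0; see nsubP and nsub_uniq. *)
Definition nsub p f (a b : Ntilde p f) : Ntilde p f := a + b *+ (p ^ f - 2).

Lemma Ntilde_absorb p f (a b : Ntilde p f) :
  a != 0 -> a + b *+ (p ^ f).-1 = a.
Proof.
rewrite -[a]reprK -[b]reprK; move: (repr a) (repr b) => {a b} n m n_neq0.
have -> k : \pi_(Ntilde p f) m *+ k = \pi_(Ntilde p f) (k * m)%N.
  by elim: k => [|k IHk]; rewrite ?mul0n // mulrS IHk mulSn pi_NtildeD.
rewrite -pi_NtildeD; apply/eqP; rewrite Ntilde_eq /nsim.
rewrite pi_Ntilde_eq0 in n_neq0.
apply/orP; right; rewrite -modnDmr modnMr addn0 eqxx; by rewrite andbT !lt0n addn_eq0 negb_and n_neq0.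
Qed.

Lemma Nadd_eq0 p f (a b : Ntilde p f) : (a + b == 0) = (a == 0) && (b == 0).
Proof.
rewrite -[a]reprK -[b]reprK -pi_NtildeD !pi_Ntilde_eq0; exact: addn_eq0.
Qed.

Lemma nsubP p f (a b : Ntilde p f) : (1 < p ^ f)%N ->
  a != 0 -> nsub a b != 0 /\ b + nsub a b = a.
Proof.
move=> q_gt1 a_neq0; split; first by rewrite Nadd_eq0 negb_and a_neq0.
rewrite /nsub addrCA -mulrS; have -> : (p ^ f - 2).+1 = (p ^ f).-1 by lia.
exact: Ntilde_absorb.
Qed.

Lemma nsub_uniq p f (a b c : Ntilde p f) : (1 < p ^ f)%N ->
  c != 0 -> b + c = a -> c = nsub a b.
Proof.
move=> q_gt1 c_neq0 <-; rewrite /nsub addrAC -mulrS addrC.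
have -> : (p ^ f - 2).+1 = (p ^ f).-1 by lia.
by rewrite Ntilde_absorb.
Qed.

(* The index i - 1 in Z/fZ is [ord_pred i]. *)
Definition is_carry_set p f (a b : Ntilde p f) (I : {set 'I_f}) : bool :=
  [forall i : 'I_f,
    let s := (digit a i + digit b i)%N in
    [&& (ord_pred i \notin I) && (i \notin I) ==> (s <= p - 1)%N,
        (ord_pred i \in I) && (i \notin I) ==> (s <= p - 2)%N,
        (ord_pred i \notin I) && (i \in I) ==> (p <= s)%N &
        (ord_pred i \in I) && (i \in I) ==> (p - 1 <= s)%N]] &&
  ([forall i : 'I_f, (digit a i + digit b i)%N == (p - 1)%N] ==> (I == set0)).

Definition carry_set p f (a b : Ntilde p f) : {set 'I_f} :=
  odflt set0 [pick I | is_carry_set a b I].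

Lemma is_carry_setE p f (a b : Ntilde p f) I : (1 < p)%N ->
  is_carry_set a b I =
  [forall i, (i \in I) == (p <= digit a i + digit b i + (ord_pred i \in I))%N]
  && ([forall i : 'I_f, (digit a i + digit b i)%N == (p - 1)%N] ==>
      (I == set0)).
Proof.
move=> p_gt1; congr (_ && _); apply: eq_forallb => i /=.
by case: (ord_pred i \in I) (i \in I) => [] [] /=; lia.
Qed.

Lemma carry_set_ex p f (a b : Ntilde p f) : (1 < p)%N ->
  exists I, is_carry_set a b I.
Proof.
move=> p_gt1.
pose F (J : {set 'I_f}) :=
  [set i | (p <= digit a i + digit b i + (ord_pred i \in J))%N].
have F_mono : {homo F : J K / J \subset K}.
  move=> J K JK; apply/subsetP=> i; rewrite !inE.
  have := subsetP JK (ord_pred i).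
  by case: (_ \in J) => [->//|_]; case: (_ \in K); lia.
exists (fixset F); rewrite is_carry_setE //; apply/andP; split.
  by apply/forallP=> i; rewrite -{1}(fixsetK F_mono) inE.
apply/implyP=> /forallP H; rewrite -subset0.
suff F0 : F set0 = set0.
  by rewrite /fixset; elim: #|_| => //= n; rewrite subset0 => /eqP->; rewrite F0.
apply/setP=> i; rewrite !inE (eqP (H i)); lia.
Qed.

Lemma is_carry_set_uniq p f (a b : Ntilde p f) I J : (1 < p)%N ->
  is_carry_set a b I -> is_carry_set a b J -> I = J.
Proof.
move=> p_gt1; rewrite !is_carry_setE // => /andP[/forallP HI HI0].
move=> /andP[/forallP HJ HJ0].
have [H|] := boolP [forall i : 'I_f, digit a i + digit b i == p - 1]%N.
  by move: HI0 HJ0; rewrite H => /eqP-> /eqP->.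
rewrite negb_forall => /existsP[i0 Hi0].
have step i : (i \in I) = (i \in J) -> (ordS i \in I) = (ordS i \in J).
  by rewrite (eqP (HI (ordS i))) (eqP (HJ (ordS i))) ordSK => ->.
have base : (i0 \in I) = (i0 \in J).
  by rewrite (eqP (HI i0)) (eqP (HJ i0)); do 2!case: (_ \in _); lia.
have iterE n : (iter n (@ordS f) i0 \in I) = (iter n (@ordS f) i0 \in J).
  by elim: n => //= n IHn; apply: step.
have f_gt0 : (0 < f)%N by case: (i0) => k /=; lia.
have iter_val n : nat_of_ord (iter n (@ordS f) i0) = ((nat_of_ord i0 + n) %% f)%N.
  elim: n => [|n IHn] /=; first by rewrite addn0 modn_small.
  by rewrite IHn -addn1 modnDml addn1 addnS.
apply/setP=> i; have := iterE (i + (f - i0))%N.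
suff -> : iter (i + (f - i0)) (@ordS f) i0 = i by [].
apply: ord_inj; rewrite iter_val.
have -> : (i0 + (i + (f - i0)) = i + f)%N by have := ltn_ord i0; lia.
by rewrite modnDr modn_small.
Qed.

Lemma carry_setP p f (a b : Ntilde p f) : (1 < p)%N ->
  is_carry_set a b (carry_set a b).
Proof.
move=> p_gt1; rewrite /carry_set; case: pickP => //= H.
by have [I] := carry_set_ex a b p_gt1; rewrite H.
Qed.

(* [None] is the symbol infinity. *)
Definition Theta p f : Type := (option (Ntilde p f) * Ntilde p f)%type.
HB.instance Definition _ p f := Choice.on (Theta p f).

Inductive theta_le p f (r : Ntilde p f) : Theta p f -> Theta p f -> Prop :=
| theta_le_refl x : theta_le r x x
| theta_le_trans y x z : theta_le r x y -> theta_le r y z -> theta_le r x z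
| theta_le1 (m : 'I_f) (j0 j1 : Ntilde p f) : prece (Npow p m) j0 ->
    theta_le r (Some (ominus j0 (Npow p m)), j1) (Some j0, j1)
| theta_le2 (m : 'I_f) (j0 j1 : Ntilde p f) : prece (Npow p m) j1 ->
    theta_le r (Some j0, ominus j1 (Npow p m)) (Some j0, j1)
| theta_le3 (m : 'I_f) (j0 j1 : Ntilde p f) : prece (Npow p m) j1 ->
    theta_le r (Some (j0 + Npow p m), ominus j1 (Npow p m)) (Some j0, j1)
| theta_le4 (j0 j1 : Ntilde p f) : j0 != 0 ->
    theta_le r (Some (nsub (nsub r (j1 *+ 2)) j0), j1) (Some j0, j1)
| theta_le5 (m : 'I_f) (j1 : Ntilde p f) : prece (Npow p m) j1 ->
    theta_le r (Some (nsub r (j1 *+ 2)), ominus j1 (Npow p m)) (None, j1)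
| theta_le6 (m : 'I_f) (j1 : Ntilde p f) :
    prece (Npow p m) (nsub r (j1 *+ 2)) ->
    theta_le r (Some (ominus (nsub r (j1 *+ 2)) (Npow p m)), j1) (None, j1)
| theta_le7 (j1 : Ntilde p f) : theta_le r (Some 0, j1) (None, j1)
| theta_le7' (j1 : Ntilde p f) : theta_le r (None, j1) (Some 0, j1).

Definition theta_equiv p f (r : Ntilde p f) : rel (Theta p f) :=
  fun x y => `[< theta_le r x y /\ theta_le r y x >].

Lemma theta_equiv_refl p f (r : Ntilde p f) : reflexive (theta_equiv r).
Proof. by move=> x; apply/asboolP; split; apply: theta_le_refl. Qed.

Lemma theta_equiv_sym p f (r : Ntilde p f) : symmetric (theta_equiv r).
Proof. by move=> x y; apply/asboolP/asboolP => -[]. Qed.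

Lemma theta_equiv_trans p f (r : Ntilde p f) : transitive (theta_equiv r).
Proof.
move=> y x z /asboolP[xy yx] /asboolP[yz zy]; apply/asboolP; split.
  exact: theta_le_trans xy yz.
exact: theta_le_trans zy yx.
Qed.

Canonical theta_equivRel p f (r : Ntilde p f) := EquivRel (theta_equiv r)
  (@theta_equiv_refl p f r) (@theta_equiv_sym p f r) (@theta_equiv_trans p f r).

Definition theta_type p f (r : Ntilde p f) : Type := {eq_quot theta_equivRel r}.

HB.instance Definition _ p f (r : Ntilde p f) := Choice.on (theta_type r).
HB.instance Definition _ p f (r : Ntilde p f) := EqQuotient.on (theta_type r).

Definition type_le p f (r : Ntilde p f) : rel (theta_type r) :=
  fun t' t => `[< theta_le r (repr t') (repr t) >].

Lemma theta_le_repr p f (r : Ntilde p f) x :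
  theta_equiv r (repr (\pi_(theta_type r) x)) x.
Proof. by apply/eqmodP; rewrite reprK. Qed.

Lemma type_leP p f (r : Ntilde p f) x y :
  reflect (theta_le r x y) (type_le (\pi_(theta_type r) x) (\pi_(theta_type r) y)).
Proof.
have /asboolP[xx' x'x] := theta_le_repr r x.
have /asboolP[yy' y'y] := theta_le_repr r y.
apply: (iffP (asboolP _)) => xy.
  exact: theta_le_trans x'x (theta_le_trans xy yy').
exact: theta_le_trans xx' (theta_le_trans xy y'y).
Qed.

Lemma type_le_refl p f (r : Ntilde p f) : reflexive (@type_le p f r).
Proof. by move=> t; apply/asboolP; apply: theta_le_refl. Qed.

Lemma type_le_anti p f (r : Ntilde p f) : antisymmetric (@type_le p f r).
Proof.
move=> t u /andP[/asboolP tu /asboolP ut]; rewrite -[t]reprK -[u]reprK.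
by apply/eqmodP; apply/asboolP.
Qed.

Lemma type_le_trans p f (r : Ntilde p f) : transitive (@type_le p f r).
Proof.
move=> u t v /asboolP tu /asboolP uv; apply/asboolP.
exact: theta_le_trans tu uv.
Qed.

Fact type_display : Order.disp_t. Proof. exact: (Order.Disp tt tt). Qed.

HB.instance Definition _ p f (r : Ntilde p f) :=
  Order.Le_isPOrder.Build type_display (theta_type r)
    (@type_le_refl p f r) (@type_le_anti p f r) (@type_le_trans p f r).

Lemma theta_type_leP p f (r : Ntilde p f) x y :
  reflect (theta_le r x y) (\pi_(theta_type r) x <= \pi_(theta_type r) y)%O.
Proof. exact: type_leP. Qed.

Definition encodes p f (r : Ntilde p f) (I : {set 'I_f}) (g : Ntilde p f)
    (t : theta_type r) : Prop :=
  exists2 j0 : Ntilde p f, t = \pi_(theta_type r) (Some j0, g) &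
    I = carry_set j0 (nsub (nsub r (g *+ 2)) j0).

Lemma encodes_ex p f (r : Ntilde p f) (t : theta_type r) :
  exists I g, encodes I g t.
Proof.
suff [j0 [g ->]] : exists j0 g, t = \pi_(theta_type r) (Some j0, g).
  by do 2!eexists; exists j0.
rewrite -[t]reprK; case: (repr t) => -[j0|] g; first by exists j0, g.
exists 0, g; apply/eqmodP; apply/asboolP.
by split; [apply: theta_le7' | apply: theta_le7].
Qed.

(* Main.v *)
Require Import Defs.
From mathcomp Require Import all_boot all_order all_algebra.
From mathcomp Require Import zify.

(** Write [s g] for [r - 2g].  A pair [(j0, g)] of Theta is the same thing as a
    decomposition [a + b = s g] with [a = j0]; the symbol infinity is the
    decomposition [s g + 0].  The set encoding the type of [(j0, g)] is then the
    set of positions where the addition of [a] and [b] produces a carry, and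
    everything rests on two facts about the indicator function [carry a b] of
    the carry set.

    - The digits of a sum obey [digit (a + b) i + p * carry a b i =
      digit a i + digit b i + carry a b (i - 1)] ([digitD]).
    - This equation determines the carries, because [p * u i = u (i - 1)] around
      a cycle forces [u = 0] ([carry_uniq]).  Hence the total number of carries
      at a position, when several elements are added, does not depend on the
      order of the additions ([carry_exchange], [carry_assoc]).

    Lowering [g] to [g'] changes [s g] into [s g' = s g + d + d], where
    [d = g - g'] digit by digit.  The union of the last two sets of the theorem
    is the support of the total carry [doubling_carry (s g) d] of this sum,
    which is additive along a chain of levels ([doubling_carryD]).

    Necessity.  Condition (i) together with the inclusion (ii), written as the
    inequality [dominated] between carries, is reflexive and transitive by that
    additivity, and each generator of the preorder satisfies it by independence
    of the order of additions ([theta_le_dominated]).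

    Sufficiency, at a fixed level.  The generators allow exchanging [a] and [b],
    and moving a part of [a] over to [b] when it is subtracted without borrow
    ([theta_split_swap], [theta_split_shift]).  Moving as much as possible from
    [b] to [a] without changing the carries gives the normal form of digits
    [min (p - 1) (a_i + b_i)] and [max 0 (a_i + b_i - (p - 1))].  When the
    carry set of [(a', b')] lies in that of [(a, b)], the small half of the
    normal form of [(a', b')] is digitwise below the large half of the normal
    form of [(a, b)], and one more shift joins the two ([theta_split_fibre]).

    Sufficiency, between levels.  One goes down one power of [p] at a time, from
    the normal form [(a, b)] to [(a, b + 2p^m)].  The carries at the lower level
    may be fewer than [carry a b + carry s (2p^m)] allows, but [carry_transfer]
    shows that no position of the target carry set is lost: a lost position [i]
    would force [i - 1] to be lost too, and this cannot go on past [m]. *)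

Set Implicit Arguments.
Unset Strict Implicit.
Unset Printing Implicit Defensive.

Import GRing.Theory.

Local Open Scope quotient_scope.
Local Open Scope ring_scope.

Section Types.
Context (p f : nat) (p_gt1 : (1 < p)%N) (f_gt0 : (0 < f)%N).

Local Notation N := (Ntilde p f).
Implicit Types (a b c d e g s x y : Ntilde p f) (i j k m : 'I_f).

(** * Digits *)

Lemma q_gt1 : (1 < p ^ f)%N.
Proof. by rewrite -(exp1n f) ltn_exp2r. Qed.
Local Hint Resolve p_gt1 q_gt1 : core.

Lemma digit_lt a i : (digit a i < p)%N.
Proof. by rewrite /digit ltn_mod; lia. Qed.

Lemma digit_inj a b : digit a =1 digit b -> a = b.
Proof.
move=> ab; rewrite -[a]canonK -[b]canonK !canon_sum //.
by under eq_bigr do rewrite ab.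
Qed.

Definition of_digits (d : 'I_f -> nat) : N :=
  \pi_N (\sum_(i < f) d i * p ^ i)%N.

Lemma of_digitsK (d : 'I_f -> nat) i :
  (forall j, d j < p)%N -> digit (of_digits d) i = d i.
Proof.
move=> d_lt; pose e (j : nat) := if insub j is Some k then d k else 0%N.
have eE k : e (nat_of_ord k) = d k by rewrite /e valK.
have e_lt (j : nat) : (e j < p)%N by rewrite /e; case: insub => [k|]; last lia.
rewrite /of_digits; under eq_bigr do rewrite -eE.
rewrite /digit (@canon_uniq p f _ (\sum_(j < f) e j * p ^ j)%N) //.
  by rewrite digit_sum.
exact: sum_digits_lt.
Qed.

Lemma digit0 i : digit (0 : N) i = 0%N.
Proof.
by rewrite /digit (@canon_uniq p f _ 0%N) ?div0n ?mod0n //; move: q_gt1; lia.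
Qed.

Lemma digit_eq0P a : reflect (forall i, digit a i = 0%N) (a == 0).
Proof.
apply: (iffP eqP) => [-> i|a0]; first exact: digit0.
by apply: digit_inj => i; rewrite digit0.
Qed.

Lemma digit_Npow m i : digit (Npow p m) i = (i == m).
Proof.
have -> : Npow p m = of_digits (fun j => (j == m) : nat).
  rewrite /Npow /of_digits (bigD1 m) //= eqxx mul1n big1 ?addn0 //.
  by move=> j /negbTE ->.
by rewrite of_digitsK // => j; case: (j == m) => /=; lia.
Qed.

Lemma Npow_neq0 m : Npow p m != 0.
Proof. by apply/digit_eq0P => /(_ m); rewrite digit_Npow eqxx. Qed.

Lemma nsub_neq0 a b : a != 0 -> nsub a b != 0.
Proof. by move=> /(nsubP b q_gt1)[]. Qed.

Lemma nsubK a b : a != 0 -> b + nsub a b = a.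
Proof. by move=> /(nsubP b q_gt1)[]. Qed.

Lemma nsubE a b c : c != 0 -> b + c = a -> nsub a b = c.
Proof. by move=> c0 /(nsub_uniq q_gt1 c0). Qed.

Lemma addI_neq0 a b c : b != 0 -> c != 0 -> a + b = a + c -> b = c.
Proof. by move=> b0 c0 /(nsubE b0) <-; apply: nsubE. Qed.

Lemma ord_pred_ind (P : 'I_f -> Prop) i0 :
  P i0 -> (forall i, P i -> P (ord_pred i)) -> forall i, P i.
Proof.
move=> P0 Pp.
have PS n j : P (iter n (@ordS f) j) -> P j.
  by elim: n j => //= n IH j /Pp; rewrite ordSK; apply: IH.
have iter_val n j : nat_of_ord (iter n (@ordS f) j) = ((j + n) %% f)%N.
  elim: n => [|n IHn] /=; first by rewrite addn0 modn_small.
  by rewrite IHn -addn1 modnDml addn1 addnS.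
move=> i; apply: (PS (i0 + (f - i))%N).
suff -> : iter (i0 + (f - i)) (@ordS f) i = i0 by [].
apply: ord_inj; rewrite iter_val.
have -> : (i + (i0 + (f - i)) = i0 + f)%N by have := ltn_ord i; lia.
by rewrite modnDr modn_small.
Qed.

(** * Carries *)

Definition carry a b i : nat := i \in carry_set a b.

Lemma carryE a b i :
  carry a b i = (p <= digit a i + digit b i + carry a b (ord_pred i))%N.
Proof.
have := carry_setP a b p_gt1; rewrite is_carry_setE // => /andP[/forallP/(_ i)].
by move=> /eqP H _; rewrite {1}/carry H.
Qed.

Lemma carry_set_full a b :
  (forall i, digit a i + digit b i = p - 1)%N -> carry_set a b = set0.
Proof.
move=> ab; have /andP[_] := carry_setP a b p_gt1.
by move=> /implyP h; apply/eqP/h/forallP => i; apply/eqP.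
Qed.

Lemma carry_le1 a b i : (carry a b i <= 1)%N.
Proof. by rewrite /carry; case: (_ \in _). Qed.

(** The right-hand side minus [p * carry a b i] is a digit, and these digits add
    up to [a + b] modulo [q - 1], the carry out of position [f - 1] coming back
    at position [0].  As Ntilde separates [0] from [q - 1], it remains to see
    that the digits are not all zero unless [a] and [b] are: this is what the
    minimality clause in the definition of the carry set is for. *)
Lemma digitD a b i : (digit (a + b)%R i + p * carry a b i =
                      digit a i + digit b i + carry a b (ord_pred i))%N.
Proof.
pose d j := (digit a j + digit b j + carry a b (ord_pred j)
             - p * carry a b j)%N.
have dE j : (d j + p * carry a b j =
             digit a j + digit b j + carry a b (ord_pred j))%N.
  by rewrite /d; have := carryE a b j; have := carry_le1 a b j; nia.
have d_lt j : (d j < p)%N.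
  rewrite /d; have := carryE a b j; have := carry_le1 a b (ord_pred j).
  by have := digit_lt a j; have := digit_lt b j; nia.
suff -> : a + b = of_digits d by rewrite of_digitsK.
have shift : (\sum_(i < f) carry a b (ord_pred i) * p ^ i
    + (\sum_(i < f) carry a b i * (i.+1 == f)) * (p ^ f).-1
    = p * \sum_(i < f) carry a b i * p ^ i)%N.
  rewrite (reindex_inj (@ordS_inj f)) big_distrl big_distrr -big_split /=.
  apply: eq_bigr => j _; rewrite ordSK -mulnA -mulnDr mulnCA -expnS.
  have [jf|jf] := eqVneq j.+1 f.
    by rewrite jf modnn expn0 mul1n; congr muln; move: q_gt1; lia.
  by rewrite modn_small ?mul0n ?addn0 //; have := ltn_ord j; lia.
have sumd : (\sum_(i < f) d i * p ^ i
    + (\sum_(i < f) carry a b i * (i.+1 == f)) * (p ^ f).-1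
    = canon a + canon b)%N.
  apply/eqP; rewrite -(eqn_add2r (\sum_(i < f) carry a b (ord_pred i) * p ^ i)).
  rewrite -addnA [X in (_ + X)%N]addnC shift !canon_sum // big_distrr /=.
  rewrite -!big_split /=; apply/eqP/eq_bigr => j _.
  by rewrite -!mulnDl mulnA -mulnDl dE.
rewrite -[a]canonK -[b]canonK -pi_NtildeD -sumd.
have no_carry :
    (\sum_(i < f) d i * p ^ i == 0)%N -> forall j, carry a b j = 0%N.
  rewrite sum_nat_eq0 => /forallP d0.
  have {}d0 j : d j = 0%N by have := d0 j; rewrite muln_eq0 expn_eq0; lia.
  move=> i0; apply/eqP; case: eqP => // /eqP ci0.
  have full j : carry a b j = 1%N.
    have := carry_le1 a b j; case cj: (carry a b j) => [|[|n]] // _.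
    have c0 : forall k, carry a b k = 0%N.
      by apply: (ord_pred_ind cj) => k ck; have := dE k; rewrite d0 ck; lia.
    by rewrite c0 in ci0.
  move: ci0; rewrite /carry carry_set_full ?inE // => j.
  by have := dE j; rewrite d0 !full; lia.
have wrap0 : (\sum_(i < f) d i * p ^ i == 0)%N ->
    (\sum_(i < f) carry a b i * (i.+1 == f) = 0)%N.
  by move=> /no_carry c0; apply: big1 => j _; rewrite c0.
apply/eqP; rewrite Ntilde_eq /nsim; move: wrap0.
set S := (\sum_(i < f) d i * p ^ i)%N; set K := (\sum_(i < f) _)%N.
rewrite addnC modnMDl eqxx andbT addn_eq0.
by case: (S) => [->|n _]; rewrite ?mul0n // !andbF andbT addnS.
Qed.

(** The differences [w i = |u i - v i|] satisfy [p * w i = w (i - 1)], so their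
    sum [W] over the cycle satisfies [p * W = W], and [W = 0]. *)
Lemma carry_uniq (u v : 'I_f -> nat) :
  (forall i, p * u i + v (ord_pred i) = p * v i + u (ord_pred i))%N -> u =1 v.
Proof.
move=> uv; pose w i := ((u i - v i) + (v i - u i))%N.
have wE i : (p * w i = w (ord_pred i))%N.
  have := uv i; rewrite /w mulnDr !mulnBr.
  move: (p * u i)%N (p * v i)%N => x y.
  move: (u _) (v _) => x1 y1; lia.
have : (p * \sum_(i < f) w i = \sum_(i < f) w i)%N.
  rewrite [in RHS](reindex_inj (can_inj (@ord_predK f))) big_distrr /=.
  by apply: eq_bigr => i _; rewrite wE.
move=> S; have /eqP : (\sum_(i < f) w i = 0)%N by nia.
by rewrite sum_nat_eq0 => /forallP w0 i; have := w0 i; rewrite /w; lia.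
Qed.

(** Both sides solve the digit equation of the sum of the four elements. *)
Lemma carry_exchange a b c d i :
  (carry a b i + carry c d i + carry (a + b)%R (c + d)%R i =
   carry a c i + carry b d i + carry (a + c)%R (b + d)%R i)%N.
Proof.
move: i; apply: carry_uniq => i.
have := digitD a b i; have := digitD c d i; have := digitD (a + b) (c + d) i.
have := digitD a c i; have := digitD b d i; have := digitD (a + c) (b + d) i.
have -> : a + b + (c + d) = a + c + (b + d) by rewrite addrACA.
lia.
Qed.

Lemma carryC a b i : carry a b i = carry b a i.
Proof.
move: i; apply: carry_uniq => i.
have := digitD a b i; have := digitD b a i.
have -> : b + a = a + b by rewrite addrC.
lia.
Qed.

Lemma carry0r a i : carry a 0 i = 0%N.
Proof.
move: i; apply: carry_uniq => i.
have := digitD a 0 i; have -> : a + 0 = a by rewrite addr0.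
by rewrite digit0; lia.
Qed.

Lemma carry0l a i : carry 0 a i = 0%N.
Proof. by rewrite carryC carry0r. Qed.

Lemma carry_assoc a b c i :
  (carry a b i + carry (a + b)%R c i = carry b c i + carry a (b + c)%R i)%N.
Proof.
have := carry_exchange a b 0 c i; rewrite carry0l carry0r.
have -> : 0 + c = c by rewrite add0r.
have -> : a + 0 = a by rewrite addr0.
lia.
Qed.

(** A carry that goes on from position to position must have been created
    somewhere: otherwise it goes round the whole cycle with all digit sums
    equal to [p - 1], and then the carry set is empty. *)
Lemma carry_start a b i :
  carry a b i = 1%N -> exists k, (p <= digit a k + digit b k)%N.
Proof.
move=> ci; case: (boolP [exists k, (p <= digit a k + digit b k)%N]).
  by move=> /existsP[k]; exists k.
move=> /existsPn ab.
have full j : carry a b j = 1%N.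
  apply: (ord_pred_ind (P := fun k => carry a b k = 1%N) ci) => k ck.
  have := carryE a b k; have := carry_le1 a b (ord_pred k); have := ab k.
  by rewrite ck; lia.
move: ci; rewrite /carry carry_set_full ?inE // => j.
by have := carryE a b j; have := ab j; rewrite !full; lia.
Qed.

(** * Sums without carry *)

Definition nocarry a b := forall i, carry a b i = 0%N.

Lemma nocarryP a b :
  nocarry a b <-> (forall i, digit a i + digit b i < p)%N.
Proof.
split=> ab i.
  by have := digitD a b i; rewrite !ab; have := digit_lt (a + b) i; lia.
have := carry_le1 a b i; case ci: (carry a b i) => [|[|n]] // _.
by have [k] := carry_start ci; have := ab k; lia.
Qed.

Lemma nocarryD a b i :
  nocarry a b -> digit (a + b) i = (digit a i + digit b i)%N.
Proof. by move=> ab; have := digitD a b i; rewrite !ab; lia. Qed.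

Lemma nocarryC a b : nocarry a b -> nocarry b a.
Proof. by move=> ab i; rewrite carryC. Qed.

Lemma nocarry_assocl a b c :
  nocarry b c -> nocarry a (b + c) -> nocarry a b /\ nocarry (a + b) c.
Proof.
by move=> bc abc; split=> i; have := carry_assoc a b c i; rewrite bc abc; lia.
Qed.

Lemma nocarry_assocr a b c :
  nocarry a b -> nocarry (a + b) c -> nocarry b c /\ nocarry a (b + c).
Proof.
by move=> ab abc; split=> i; have := carry_assoc a b c i; rewrite ab abc; lia.
Qed.

Lemma nocarry_prece a b : nocarry a b -> prece a (a + b).
Proof. by move=> ab; apply/forallP => i; rewrite nocarryD // leq_addr. Qed.

Lemma nocarryK a b : nocarry a b -> ominus (a + b) a = b.
Proof.
move=> ab; apply: digit_inj => i.
by rewrite digit_ominus // nocarryD //; lia.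
Qed.

Lemma prece_nocarry a b : prece a b -> nocarry a (ominus b a).
Proof.
move=> /forallP ab; apply/nocarryP => i; rewrite digit_ominus //.
by have := ab i; have := digit_lt b i; lia.
Qed.

Lemma ominusK a b : prece a b -> a + ominus b a = b.
Proof.
move=> ab; apply: digit_inj => i; rewrite nocarryD; last exact: prece_nocarry.
by rewrite digit_ominus //; move/forallP/(_ i): ab; lia.
Qed.

Lemma Ntilde_ind (P : N -> Prop) :
  P 0 -> (forall m x, nocarry (Npow p m) x -> P x -> P (Npow p m + x)) ->
  forall x, P x.
Proof.
move=> P0 PD x; have [n] := ubnP (\sum_i digit x i)%N; elim: n x => // n IH x.
have [/existsP[m xm]|/existsPn x0] := boolP [exists m, digit x m != 0%N];
    last first.
  move=> _; suff -> : x = 0 by [].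
  by apply/eqP/digit_eq0P => i; have := x0 i; lia.
have mx : prece (Npow p m) x.
  by apply/forallP => i; rewrite digit_Npow; case: eqP => // ->; lia.
have mx' := prece_nocarry mx.
rewrite -(ominusK mx); move: (ominus x _) mx' => y my.
under eq_bigr do rewrite nocarryD // digit_Npow.
rewrite big_split /= (bigD1 m) //= eqxx ltnS => lt.
apply: PD => //; apply: IH; apply: leq_trans lt.
by rewrite -addnA add1n ltnS leq_addl.
Qed.

(** * The normal form of a decomposition *)

(** [movable a b] is the largest part of [b] that can be moved over to [a]
    without changing the carries; [excess a b] is what remains of [b]. *)
Definition excess a b : N :=
  of_digits (fun i => (digit a i + digit b i - p.-1)%N).

Definition movable a b : N := ominus b (excess a b).

Lemma digit_excess a b i :
  digit (excess a b) i = (digit a i + digit b i - p.-1)%N.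
Proof.
rewrite of_digitsK // => j.
by have := digit_lt a j; have := digit_lt b j; lia.
Qed.

Lemma excessC a b : excess a b = excess b a.
Proof. by apply: digit_inj => i; rewrite !digit_excess addnC. Qed.

Lemma prece_excess a b : prece (excess a b) b.
Proof.
by apply/forallP => i; rewrite digit_excess; have := digit_lt a i; lia.
Qed.

Lemma excessK a b : excess a b + movable a b = b.
Proof. exact: ominusK (prece_excess a b). Qed.

Lemma nocarry_excess a b : nocarry (movable a b) (excess a b).
Proof. exact: nocarryC (prece_nocarry (prece_excess a b)). Qed.

Lemma nocarry_movable a b : nocarry (movable a b) a.
Proof.
apply/nocarryP => i; rewrite digit_ominus // digit_excess.
by have := digit_lt a i; have := digit_lt b i; lia.
Qed.

Lemma saturateD a b : (movable a b + a) + excess a b = a + b.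
Proof. by rewrite addrAC addrC -[movable a b + _]addrC excessK. Qed.

Lemma digit_saturate a b i :
  digit (movable a b + a) i = minn p.-1 (digit a i + digit b i).
Proof.
rewrite nocarryD; last exact: nocarry_movable.
rewrite digit_ominus // digit_excess.
by have := digit_lt a i; have := digit_lt b i; lia.
Qed.

Lemma carry_saturate a b i :
  carry (movable a b + a) (excess a b) i = carry a b i.
Proof.
have := carry_assoc a (movable a b) (excess a b) i.
rewrite nocarry_excess (nocarryC (nocarry_movable a b)).
have -> : movable a b + excess a b = b by rewrite addrC excessK.
have -> : a + movable a b = movable a b + a by rewrite addrC.
lia.
Qed.

Lemma excess_carry a b i : (0 < digit (excess a b) i)%N -> carry a b i = 1%N.
Proof.
by rewrite digit_excess; have := carryE a b i; have := carry_le1 a b i; lia.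
Qed.

(** * Adding an element twice *)

Context (p_gt2 : (2 < p)%N).

(** The total number of carries at [i] in the sum [s + d + d]. *)
Definition doubling_carry s d i : nat :=
  (carry s (d *+ 2)%R i + carry d d i)%N.

Lemma doubling_carry0 s i : doubling_carry s 0 i = 0%N.
Proof. by rewrite /doubling_carry mul0rn !carry0r. Qed.

(** Adding [e + d] twice is adding [e] twice and then [d] twice. *)
Lemma doubling_carryD s e d i : nocarry e d ->
  (doubling_carry s (e + d)%R i =
   doubling_carry s e i + doubling_carry (s + e *+ 2)%R d i)%N.
Proof.
move=> ed; have assoc := carry_assoc s (e *+ 2) (d *+ 2) i.
have := carry_exchange e d e d i; rewrite !ed !add0n -!mulr2n => exchange.
rewrite /doubling_carry exchange mulrnDl.
by rewrite addnCA [X in (_ + X)%N]addnC -assoc [RHS]addnACA [RHS]addnC.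
Qed.

Lemma nocarry_Npow_double m : nocarry (Npow p m) (Npow p m).
Proof.
by apply/nocarryP => i; rewrite digit_Npow; case: (i == m) => /=; lia.
Qed.

Lemma digit_Npow_double m i : digit (Npow p m *+ 2) i = ((i == m) * 2)%N.
Proof.
rewrite mulr2n nocarryD ?digit_Npow ?muln2 ?addnn //.
exact: nocarry_Npow_double.
Qed.

(** Let [(al, be)] be the normal form of [(a, b)] and [P2 = 2p^m].  Among the
    carries counted by [carry a b + carry s P2], those of [be + P2] are not
    carries of [al + (be + P2)].  If a carry of [a' + b'] at [i] were lost in
    this way, without being supplied by [d], then [i] would be a carry of
    [be + P2] and of [a + b] but not of [s + P2], and this forces the digit at
    [i] of [s1 = s + P2] to be [p - 1].  As no carry comes from [d], the digit
    of [s2 = a' + b'] is [p - 1] too, which is compatible with a carry of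
    [a' + b'] at [i] only if there is one at [i - 1].  If [i <> m], that one is
    lost as well, so that losses propagate backwards until [m].  There it is
    impossible, because no carry reaches [m] from [a + b], [s + P2] or [d]. *)
Lemma carry_transfer m s a b d a' b' :
  a + b = s -> a' + b' = s + Npow p m *+ 2 + d *+ 2 ->
  (forall i, carry a' b' i <= carry a b i + carry s (Npow p m *+ 2)%R i
     + doubling_carry (s + Npow p m *+ 2)%R d i)%N ->
  forall i, (carry a' b' i <=
     carry (movable a b + a)%R (excess a b + Npow p m *+ 2)%R i
     + doubling_carry (s + Npow p m *+ 2)%R d i)%N.
Proof.
move=> abs; set s1 := s + _; set s2 := s1 + _ => abs' cover i0.
set al := movable a b + a; set be := excess a b.
set P2 := Npow p m *+ 2 in s1 s2 abs' cover *.
rewrite leqNgt; apply/negP => bad.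
have balance i : (carry al (be + P2)%R i + carry be P2 i =
                  carry a b i + carry s P2 i)%N.
  have := carry_assoc al be P2 i; rewrite carry_saturate.
  have -> : al + be = s by rewrite saturateD.
  lia.
have beE i : carry a b i = 1%N ->
    (digit be i + carry a b (ord_pred i) = digit s i + 1)%N.
  move=> ci; rewrite digit_excess -abs; have := digitD a b i.
  have := carryE a b i; have := carry_le1 a b (ord_pred i).
  by have := digit_lt (a + b) i; rewrite ci; lia.
(* The carries of be + P2 can only be created at m. *)
have be_m i : carry be P2 i = 1%N -> (p <= digit be m + 2)%N.
  case/carry_start => k; rewrite digit_Npow_double; have := digit_lt be k.
  by case: eqP => [->|_] /=; lia.
have be_pos i : carry be P2 i = 1%N -> (0 < digit be i)%N.
  move=> Bi; have [->|im] := eqVneq i m; first by have := be_m i Bi; lia.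
  have := carryE be P2 i; rewrite Bi digit_Npow_double (negbTE im) /=.
  by have := carry_le1 be P2 (ord_pred i); lia.
pose lost i := [/\ carry a' b' i = 1, doubling_carry s1 d i = 0
                 & carry al (be + P2)%R i = 0]%N.
have lost0 : lost i0.
  by have := carry_le1 a' b' i0; rewrite /lost; split; lia.
have back i : lost i -> i != m /\ lost (ord_pred i).
  case=> Zi Yi Wi.
  have := cover i; have := balance i; rewrite Zi Yi Wi => bal cov.
  have := carry_le1 be P2 i => Ble; have Bi : carry be P2 i = 1%N by lia.
  have be0 := be_pos i Bi; have Ii := excess_carry be0.
  have Ci : carry s P2 i = 0%N by lia.
  have bei := beE i Ii; have s1i := digitD s P2 i.
  rewrite Ci muln0 addn0 digit_Npow_double -/s1 in s1i.
  have s1lt := digit_lt s1 i; have belt := digit_lt be i.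
  have Bstep := carryE be P2 i; rewrite Bi digit_Npow_double in Bstep.
  have Ile := carry_le1 a b (ord_pred i).
  have Ble' := carry_le1 be P2 (ord_pred i).
  have [s1top Cpred mcase] :
      [/\ digit s1 i = p.-1, carry s P2 (ord_pred i) = 0%N &
        if i == m then carry a b (ord_pred i) = 0%N
        else carry be P2 (ord_pred i) = 1%N /\ carry a b (ord_pred i) = 1%N].
    have := be_pos (ord_pred i).
    case: eqP Bstep s1i => [im|_] Bstep s1i bepos; rewrite /= in Bstep s1i.
      by have := be_m i Bi; rewrite -im => *; split; lia.
    have B1 : carry be P2 (ord_pred i) = 1%N by lia.
    have I1 := excess_carry (bepos B1).
    by rewrite I1 in bei *; split; lia.
  have [Ei Di] : carry s1 (d *+ 2) i = 0%N /\ carry d d i = 0%N.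
    by move: Yi; rewrite /doubling_carry; lia.
  have := digitD s1 (d *+ 2) i; have := digitD d d i.
  have -> : d + d = d *+ 2 by rewrite mulr2n.
  rewrite Ei Di -/s2; have s2lt := digit_lt s2 i => Deq Eeq.
  have Ypred : doubling_carry s1 d (ord_pred i) = 0%N.
    by rewrite /doubling_carry; lia.
  have Zpred : carry a' b' (ord_pred i) = 1%N.
    have := digitD a' b' i; rewrite abs' Zi.
    have := digit_lt a' i; have := digit_lt b' i.
    by have := carry_le1 a' b' (ord_pred i); lia.
  have := cover (ord_pred i); have := balance (ord_pred i).
  case: eqP mcase => [_|_] mcase bal' cov'; first by lia.
  by split=> //; split=> //; lia.
have /back [/eqP//] : lost m.
exact: (ord_pred_ind (P := lost) lost0 (fun i li => (back i li).2)).
Qed.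

(** * Decompositions as elements of Theta *)

Context (r : N) (r_neq0 : r != 0).

Local Notation "x <=r y" := (theta_le r x y) (at level 70).

Definition level_sum g : N := nsub r (g *+ 2).

Lemma level_sum_neq0 g : level_sum g != 0. Proof. exact: nsub_neq0. Qed.

Lemma level_sumD d g : level_sum (d + g) + d *+ 2 = level_sum g.
Proof.
apply/esym/nsubE; first by rewrite Nadd_eq0 negb_and level_sum_neq0.
by rewrite addrC -addrA -mulrnDl addrC nsubK.
Qed.

Lemma complement a g : exists2 b, b != 0 & a + b = level_sum g.
Proof.
exists (nsub (level_sum g) a); first exact: nsub_neq0 (level_sum_neq0 g).
exact: nsubK (level_sum_neq0 g).
Qed.

(** The element of Theta given by a decomposition [a + b = level_sum g].  The
    complement of an element of Ntilde is nonzero, so that [b = 0] is free to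
    encode infinity; this makes the generators symmetric in [a] and [b]. *)
Definition theta_split a b g : Theta p f :=
  (if b == 0 then None else Some a, g).

Lemma theta_split_swap a b g :
  a + b = level_sum g -> theta_split b a g <=r theta_split a b g.
Proof.
move=> abs; have := level_sum_neq0 g.
rewrite -abs Nadd_eq0 negb_and /theta_split.
have [b0 _|b_neq0] := eqVneq b 0.
  case: eqP => [_|_]; first exact: theta_le_refl.
  by rewrite b0; apply: theta_le7.
have [-> _|a_neq0 _] := eqVneq a 0; first exact: theta_le7'.
by rewrite -(nsubE b_neq0 abs); apply: theta_le4.
Qed.

Lemma theta_split_shift_pow m a b g : nocarry (Npow p m) a ->
  Npow p m + a + b = level_sum g ->
  theta_split a (Npow p m + b) g <=r theta_split (Npow p m + a) b g.
Proof.
move=> ma abs; rewrite /theta_split Nadd_eq0 (negbTE (Npow_neq0 m)) /=.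
rewrite -{1}(nocarryK ma); case: eqP => [b0|_]; last first.
  exact: theta_le1 (nocarry_prece ma).
rewrite b0 addr0 in abs; rewrite abs; apply: theta_le6.
by rewrite -/(level_sum g) -abs; apply: nocarry_prece.
Qed.

Lemma theta_split_shift x a b g : nocarry x a -> x + a + b = level_sum g ->
  theta_split a (x + b) g <=r theta_split (x + a) b g.
Proof.
elim/Ntilde_ind: x a b => [|m x mx IH] a b.
  by rewrite !add0r => *; exact: theta_le_refl.
move=> /(nocarry_assocr mx)[xa mxa]; rewrite -!addrA => abs.
apply: theta_le_trans (theta_split_shift_pow mxa _); last by rewrite -!addrA.
rewrite [x + b]addrC addrA [_ + x]addrC.
by apply: IH => //; rewrite -abs -addrA [a + (_ + _)]addrCA [LHS]addrCA.
Qed.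

Lemma theta_split_saturate a b g : a + b = level_sum g ->
  theta_split (movable a b + a) (excess a b) g <=r theta_split a b g.
Proof.
move=> abs; apply: theta_le_trans (theta_split_swap abs).
apply: theta_le_trans (theta_split_swap _) _; first by rewrite addrC saturateD.
rewrite -{3}(excessK a b) [excess a b + _]addrC.
apply: theta_split_shift; first exact: nocarry_excess.
by rewrite [movable a b + _]addrC excessK addrC.
Qed.

Lemma theta_split_unsaturate a b g : a + b = level_sum g ->
  theta_split a b g <=r theta_split (excess a b) (movable b a + b) g.
Proof.
move=> abs; have ba : b + a = level_sum g by rewrite addrC.
apply: theta_le_trans (theta_split_swap ba) _.
have eab : excess a b + (movable b a + b) = level_sum g.
  by rewrite excessC addrC saturateD.
apply: theta_le_trans (theta_split_swap eab).
rewrite -{1}(excessK b a) excessC [_ + movable _ _]addrC.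
apply: theta_split_shift; first exact: nocarry_movable.
by rewrite -(excessC b a) saturateD.
Qed.

(** The order at a fixed level.  The excess [ka] of [(a', b')] vanishes outside
    its carry set, and on the carry set of [(a, b)] the digits of the saturated
    half [al] of [(a, b)] are all [p - 1]; hence [ka] is digitwise below [al],
    and [al] can be shifted down to [ka]. *)
Lemma theta_split_fibre a b a' b' g :
  a + b = level_sum g -> a' + b' = level_sum g ->
  (forall i, carry a' b' i <= carry a b i)%N ->
  theta_split a' b' g <=r theta_split a b g.
Proof.
move=> abs abs' sub.
apply: theta_le_trans (theta_split_saturate abs).
apply: theta_le_trans (theta_split_unsaturate abs') _.
set al := movable a b + a; set be := excess a b.
set ka := excess a' b'; set la := movable b' a' + b'.
have kaP i : (0 < digit ka i)%N -> carry a b i = 1%N.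
  by move=> /excess_carry; have := sub i; have := carry_le1 a b i; lia.
have kal : prece ka al.
  apply/forallP => i; rewrite digit_saturate.
  have := kaP i; have := carryE a b i; have := carry_le1 a b (ord_pred i).
  by have := digit_lt ka i; lia.
have kaz := ominusK kal; have nkaz := nocarryC (prece_nocarry kal).
set z := ominus al ka in kaz nkaz *.
have albe : al + be = level_sum g by rewrite saturateD.
have kala : ka + la = level_sum g.
  by rewrite /ka excessC addrC saturateD addrC.
suff -> : la = z + be.
  have zka : z + ka = al by rewrite addrC.
  by rewrite -zka; apply: theta_split_shift => //; rewrite zka.
(* Both are complements of ka; they could differ only if one of them were 0
   and the other one q - 1. *)
apply: (@addI_neq0 ka); last by rewrite kala addrA kaz albe.
- rewrite Nadd_eq0; apply/negP => /andP[/eqP r0 /eqP b0].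
  have := excessK b' a'; rewrite r0 b0 addr0 => a'E.
  have := level_sum_neq0 g; rewrite -abs' b0 addr0 -a'E => /digit_eq0P[] i.
  by rewrite digit_excess digit0; have := digit_lt a' i; lia.
- rewrite Nadd_eq0; apply/negP => /andP[/eqP z0 /eqP be0].
  have alka : al = ka by rewrite -kaz z0 addr0.
  have := level_sum_neq0 g; rewrite -albe be0 addr0 alka => /digit_eq0P[] i.
  by have := kaP i; rewrite -carry_saturate -/al -/be be0 carry0r; lia.
Qed.

Lemma theta_split_descend m a b g :
  nocarry (Npow p m) g -> a + b = level_sum (Npow p m + g) ->
  theta_split a (b + Npow p m *+ 2) g <=r theta_split a b (Npow p m + g).
Proof.
move=> mg abs; rewrite /theta_split mulr2n 2!Nadd_eq0.
rewrite (negbTE (Npow_neq0 m)) andbF -{1}(nocarryK mg).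
case: eqP => [b0|_]; last exact: theta_le2 (nocarry_prece mg).
rewrite b0 addr0 in abs; rewrite abs.
exact: theta_le5 (nocarry_prece mg).
Qed.

(** Sufficiency of the two conditions.  The levels are crossed one power of [p]
    at a time, always from a normal form, so that [carry_transfer] carries the
    hypothesis over to the next level. *)
Lemma theta_split_le d g a b a' b' : nocarry d g ->
  a + b = level_sum (d + g) -> a' + b' = level_sum g ->
  (forall i, carry a' b' i <=
     carry a b i + doubling_carry (level_sum (d + g)%R) d i)%N ->
  theta_split a' b' g <=r theta_split a b (d + g).
Proof.
elim/Ntilde_ind: d a b => [|m d md IH] a b.
  rewrite add0r => _ abs abs' sub; apply: theta_split_fibre => // i.
  by have := sub i; rewrite doubling_carry0; lia.
move=> /(nocarry_assocr md)[dg mdg]; rewrite -!addrA => abs abs' sub.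
apply: theta_le_trans (theta_split_saturate abs).
apply: theta_le_trans (theta_split_descend mdg _); last by rewrite saturateD.
have slE := level_sumD (Npow p m) (d + g).
apply: IH => //; first by rewrite addrA saturateD abs slE.
rewrite -slE; apply: carry_transfer => // [|i].
  by rewrite slE level_sumD.
have := sub i; rewrite doubling_carryD // {1}/doubling_carry.
by rewrite nocarry_Npow_double addn0 addnA.
Qed.

(** * Carries along the preorder *)

(** The indicator function of the set encoding the type of an element of Theta;
    infinity has the type of [0], whose carry set is empty. *)
Definition theta_carry (t : Theta p f) i : nat :=
  if t.1 is Some j then carry j (nsub (level_sum t.2) j) i else 0%N.

Lemma theta_carryE a b g i :
  b != 0 -> a + b = level_sum g -> theta_carry (Some a, g) i = carry a b i.
Proof. by move=> b0 abs; rewrite /theta_carry /= (nsubE b0 abs). Qed.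

Definition dominated (t u : Theta p f) : Prop :=
  exists d, [/\ nocarry d t.2, u.2 = d + t.2 &
    forall i, (theta_carry t i <=
               theta_carry u i + doubling_carry (level_sum u.2) d i)%N].

Lemma dominated_fibre (t u : Theta p f) : t.2 = u.2 ->
  (forall i, theta_carry t i <= theta_carry u i)%N -> dominated t u.
Proof.
move=> tu sub; exists 0; split=> [i||i]; first exact: carry0l.
  by rewrite add0r.
by rewrite doubling_carry0 addn0.
Qed.

Lemma dominated_trans (t u v : Theta p f) :
  dominated t u -> dominated u v -> dominated t v.
Proof.
case=> d [dt uE sub] [e [eu vE sub']].
have [ed edt] : nocarry e d /\ nocarry (e + d) t.2.
  by apply: nocarry_assocl; rewrite -?uE.
exists (e + d); split=> // [|i]; first by rewrite vE uE addrA.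
rewrite doubling_carryD //; have := sub i; have := sub' i.
have -> : level_sum v.2 + e *+ 2 = level_sum u.2 by rewrite vE level_sumD.
lia.
Qed.

Lemma dominated_down m g (x y : option N) : prece (Npow p m) g ->
  (forall i, theta_carry (x, ominus g (Npow p m)) i <=
     theta_carry (y, g) i + carry (level_sum g) (Npow p m *+ 2)%R i)%N ->
  dominated (x, ominus g (Npow p m)) (y, g).
Proof.
move=> mg sub; exists (Npow p m); split=> [||i].
- exact: prece_nocarry.
- by rewrite /= ominusK.
by rewrite /doubling_carry nocarry_Npow_double addn0; apply: sub.
Qed.

(** Necessity of the two conditions.  For each generator, the carries of the new
    decomposition are part of a total carry that can also be computed starting
    from the old decomposition. *)
Lemma theta_le_dominated (t u : Theta p f) : t <=r u -> dominated t u.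
Proof.
elim=> {t u}.
- by move=> t; apply: dominated_fibre.
- by move=> u t v _ tu _; apply: dominated_trans.
- move=> m j0 g mj0; apply: dominated_fibre => [//|i].
  have [b b0 abs] := complement j0 g; rewrite [leqRHS](theta_carryE i b0 abs).
  have b0' : Npow p m + b != 0 by rewrite Nadd_eq0 negb_and b0 orbT.
  have abs' : ominus j0 (Npow p m) + (Npow p m + b) = level_sum g.
    by rewrite addrA [_ + Npow p m]addrC ominusK.
  rewrite (theta_carryE i b0' abs').
  have := carry_assoc (ominus j0 (Npow p m)) (Npow p m) b i.
  rewrite (nocarryC (prece_nocarry mj0)) add0n [_ + Npow p m]addrC ominusK //.
  by move=> ->; rewrite leq_addl.
- move=> m j0 g mg; apply: dominated_down => [//|i].
  have [b b0 abs] := complement j0 g.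
  rewrite [X in (_ <= X + _)%N](theta_carryE i b0 abs).
  have slE := level_sumD (Npow p m) (ominus g (Npow p m)).
  rewrite ominusK // in slE.
  have b0' : b + Npow p m *+ 2 != 0 by rewrite Nadd_eq0 negb_and b0.
  have abs' : j0 + (b + Npow p m *+ 2) = level_sum (ominus g (Npow p m)).
    by rewrite addrA abs.
  rewrite (theta_carryE i b0' abs') -abs.
  by have := carry_assoc j0 b (Npow p m *+ 2) i => ->; rewrite leq_addl.
- move=> m j0 g mg; apply: dominated_down => [//|i].
  have [b b0 abs] := complement j0 g.
  rewrite [X in (_ <= X + _)%N](theta_carryE i b0 abs).
  have slE := level_sumD (Npow p m) (ominus g (Npow p m)).
  rewrite ominusK // in slE.
  have b0' : b + Npow p m != 0 by rewrite Nadd_eq0 negb_and b0.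
  have abs' : j0 + Npow p m + (b + Npow p m) = level_sum (ominus g (Npow p m)).
    by rewrite addrACA abs -mulr2n.
  rewrite (theta_carryE i b0' abs') -abs.
  have := carry_exchange j0 b (Npow p m) (Npow p m) i.
  by rewrite nocarry_Npow_double addn0 -mulr2n => ->; rewrite leq_addl.
- move=> j0 g j00; apply: dominated_fibre => [//|i].
  have [b b0 abs] := complement j0 g; rewrite [leqRHS](theta_carryE i b0 abs).
  rewrite -/(level_sum g) (nsubE b0 abs).
  by rewrite (theta_carryE i j00 (etrans (addrC _ _) abs)) carryC leqnn.
- move=> m g mg; apply: dominated_down => [//|i].
  have slE := level_sumD (Npow p m) (ominus g (Npow p m)).
  rewrite ominusK // in slE.
  have b0 : Npow p m *+ 2 != 0 by rewrite mulr2n Nadd_eq0 negb_and Npow_neq0.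
  by rewrite -/(level_sum g) (theta_carryE i b0 slE) leq_addl.
- move=> m g mg; apply: dominated_fibre => [//|i].
  rewrite -/(level_sum g) in mg *.
  have abs : ominus (level_sum g) (Npow p m) + Npow p m = level_sum g.
    by rewrite addrC ominusK.
  rewrite (theta_carryE i (Npow_neq0 m) abs).
  by rewrite (nocarryC (prece_nocarry mg)) leq0n.
- move=> g; apply: dominated_fibre => [//|i].
  by rewrite (theta_carryE i (level_sum_neq0 g) (add0r _)) carry0l.
- by move=> g; apply: dominated_fibre.
Qed.

Lemma theta_carry_subset (j g j' g' d : N) :
  (forall i, theta_carry (Some j', g') i <=
     theta_carry (Some j, g) i + doubling_carry (level_sum g) d i)%N <->
  carry_set j' (nsub (level_sum g') j') \subset
    carry_set j (nsub (level_sum g) j) :|: carry_set (level_sum g) (d *+ 2)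
    :|: carry_set d d.
Proof.
rewrite /theta_carry /doubling_carry /carry /=.
split=> [sub|/subsetP sub i].
  apply/subsetP => i ii; have := sub i; rewrite !in_setU ii.
  by do 3! case: (_ \in _).
have := sub i; rewrite !in_setU; case: (_ \in _) => // /(_ isT).
by do 3! case: (_ \in _).
Qed.

End Types.

Theorem proposition4p14 (p f : nat) (p_prime : prime p) (p_odd : odd p)
    (f_gt0 : (0 < f)%N) (r : Ntilde p f) (r_neq0 : r != 0)
    (t t' : theta_type r) (I I' : {set 'I_f}) (g g' : Ntilde p f)
    (tE : encodes I g t) (t'E : encodes I' g' t') :
  (t' <= t)%O <->
  prece g' g /\
  I' \subset I :|: carry_set (nsub r (g *+ 2)) (ominus g g' *+ 2)
               :|: carry_set (ominus g g') (ominus g g').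
Proof.
have p_gt1 := prime_gt1 p_prime; have p_gt2 := odd_prime_gt2 p_odd p_prime.
case: tE t'E => [j -> ->] [j' -> ->].
rewrite -/(level_sum r g) -/(level_sum r g').
split=> [/theta_type_leP le_t't|[g'g sub]].
  have [d [dg' gE sub]] := theta_le_dominated p_gt1 f_gt0 p_gt2 r_neq0 le_t't.
  rewrite /= in dg' gE sub.
  have g'd := nocarryC p_gt1 f_gt0 dg'; rewrite addrC in gE.
  split; first by rewrite gE; apply: nocarry_prece.
  have -> : ominus g g' = d by rewrite gE nocarryK.
  exact/theta_carry_subset.
apply/theta_type_leP.
have dg' := nocarryC p_gt1 f_gt0 (prece_nocarry p_gt1 f_gt0 g'g).
have gE : ominus g g' + g' = g by rewrite addrC ominusK.
have [b b0 abs] := complement p_gt1 f_gt0 r_neq0 j g.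
have [b' b'0 abs'] := complement p_gt1 f_gt0 r_neq0 j' g'.
have := theta_split_le p_gt1 f_gt0 p_gt2 r_neq0 dg' (a := j) (b := b).
rewrite gE => /(_ j' b' abs abs').
rewrite /theta_split (negbTE b0) (negbTE b'0); apply=> i.
rewrite -(theta_carryE p_gt1 f_gt0 i b'0 abs').
rewrite -(theta_carryE p_gt1 f_gt0 i b0 abs).
exact: (theta_carry_subset _ _ _ _ _ _).2 sub i.
Qed.
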